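(* Let $(\Pi_\infty,\rho)$ be a self-similar ultrametric Cantor set, let $\alpha\in(0,1)$ be the parameter of $\rho$, and let $\Lambda$ be the Perron–Frobenius eigenvalue of the adjacency matrix of the underlying stationary Bratteli diagram. Then the abscissa of convergence $s_0$ of the zeta-function $$\zeta(s)=\sum_{n=0}^\infty\ \sum_{\gamma\in\Pi_n}\operatorname{diam}_\rho([\gamma])^{s}$$ exists and is given by $$s_0=\frac{\log(\Lambda)}{-\log(\alpha)}.$$
   Context: Stationary Bratteli diagram: given finite sets $\mathcal{V}$, $\mathcal{E}$ and maps $s,r:\mathcal{E}\to\mathcal{V}$ (source, range), it is the infinite oriented graph with vertex levels $V_0=\{\circ\}$ (root) and $V_n$ a copy of $\mathcal{V}$ for $n\ge1$, and edge levels $E_0$, consisting of exactly one edge from $\circ$ to each vertex of $V_1$, and, for $n\ge 1$, $E_n$ a copy of $\mathcal{E}$, where $e\in\mathcal{E}$ goes from the copy of $s(e)$ in $V_n$ to the copy of $r(e)$ in $V_{n+1}$. The adjacency matrix is $A_{vv'}=\#\{e\in\mathcal{E}: s(e)=v,\ r(e)=v'\}$, $v,v'\in\mathcal{V}$; its Perron–Frobenius eigenvalue $\Lambda$ is its nonnegative real eigenvalue equal to its spectral radius. Paths: $\Pi_n$ is the set of paths $\gamma=(e_0,\dots,e_{n-1})$ from the root to $V_n$ ($e_j\in E_j$, $r(e_j)=s(e_{j+1})$), of length $|\gamma|=n$ ($\Pi_0$ consists of the empty path); $\Pi=\bigcup_n\Pi_n$; $\Pi_\infty$ is the set of infinite paths,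 with the topology induced by the product of the discrete topologies on the $E_j$; $[\gamma]$ is the set of infinite paths with prefix $\gamma$. For $x\ne y$ in $\Pi_\infty$, $x\wedge y\in\Pi$ is the longest common prefix. Self-similar ultrametric Cantor set: such a $\Pi_\infty$ which is a Cantor set (nonempty, compact, totally disconnected, no isolated points), with an ultrametric $\rho$ of the form $\rho(x,y)=a_{x\wedge y}\,\alpha^{|x\wedge y|}$ for $x\neq y$, $\rho(x,x)=0$, where $\alpha\in(0,1)$ (the parameter of $\rho$), $a_\gamma\in(0,\infty)$ for $\gamma\in\Pi$, $0<\inf_{\gamma\in\Pi}a_\gamma\le\sup_{\gamma\in\Pi}a_\gamma<\infty$, and the weight $w(\gamma)=a_\gamma\alpha^{|\gamma|}$ is non-increasing under extension of $\gamma$. By convention $\operatorname{diam}_\rho([\gamma])=w(\gamma)=a_\gamma\alpha^{|\gamma|}$. Abscissa of convergence: the real number $s_0>0$ such that the series $\zeta(s)$ defines a holomorphic function on the half-plane $\Re(s)>s_0$ which is singular at $s_0$ (it has no holomorphic extension to a neighbourhood of $s_0$). *)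

(* Defs.v *)
From mathcomp Require Import all_boot all_order all_algebra.
From mathcomp Require Import all_classical all_reals all_analysis.
From mathcomp.real_closed Require Import complex.

Set Implicit Arguments.
Unset Strict Implicit.
Unset Printing Implicit Defensive.

Import Order.TTheory GRing.Theory Num.Theory.
Import numFieldNormedType.Exports.

Local Open Scope classical_set_scope.
Local Open Scope ring_scope.
Local Open Scope complex_scope.

Record stationary_bratteli := StationaryBratteli {
  vertex : finType;
  edge : finType;
  src : edge -> vertex;
  rng : edge -> vertex }.

Definition adjacency_matrix (F : pzRingType) (B : stationary_bratteli) :
    'M[F]_#|vertex B| :=
  \matrix_(i, j)
    #|[set e : edge B | (src e == enum_val i) && (rng e == enum_val j)]|%:R.

(* The spectral radius is the largest modulus of a complex eigenvalue. *)
Definition perron_frobenius_eigenvalue (R : realType) (B : stationary_bratteli)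
    (Lambda : R) : Prop :=
  let A := adjacency_matrix R[i] B in
  [/\ 0 <= Lambda,
      eigenvalue A Lambda%:C &
      forall mu : R[i], eigenvalue A mu -> `|mu| <= Lambda%:C].

Section Paths.
Variable B : stationary_bratteli.

(* Edges of all levels share one type: [inl v] is the edge of E_0 from the root
   to the copy of v in V_1, and [inr e] is the copy of e in any E_n, n >= 1.
   The path predicates below force [inl] at level 0 and [inr] at later levels. *)
Definition level_edge : finType := (vertex B + edge B)%type.

Definition range_of (e : level_edge) : vertex B :=
  match e with inl v => v | inr e => rng e end.

Definition consecutive (e f : level_edge) : bool :=
  match f with inl _ => false | inr f => range_of e == src f end.

Definition starts_at_root (e : level_edge) : bool :=
  if e is inl _ then true else false.

(* [Pi_n] is the set of [t : n.-tuple level_edge] with [finite_path t]. *)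
Definition finite_path (t : seq level_edge) : bool :=
  if t is e :: t' then starts_at_root e && path consecutive e t' else true.

Definition finite_paths : set (seq level_edge) := [set t | finite_path t].

Definition edge_sequence : Type :=
  prod_topology (fun _ : nat => discrete_topology level_edge).

Definition infinite_paths : set edge_sequence :=
  [set x | starts_at_root (x 0%N) /\ forall j, consecutive (x j) (x j.+1)].

Definition prefix_of (t : seq level_edge) (x : edge_sequence) : Prop :=
  t = mkseq x (size t).

(* [t] is the path written "x /\ y". *)
Definition longest_common_prefix (x y : edge_sequence) (t : seq level_edge) :
    Prop :=
  [/\ prefix_of t x, prefix_of t y &
      forall t', prefix_of t' x -> prefix_of t' y -> (size t' <= size t)%N].

End Paths.

Definition cantor_set (T : topologicalType) (A : set T) : Prop :=
  [/\ A !=set0, compact A, totally_disconnected A & isolated A = set0].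

Record ultrametric_on (R : realType) (T : Type) (A : set T) (rho : T -> T -> R) :
    Prop := UltrametricOn {
  ultrametric_ge0 : forall x y, A x -> A y -> 0 <= rho x y;
  ultrametric_eq0 : forall x y, A x -> A y -> rho x y = 0 <-> x = y;
  ultrametric_sym : forall x y, A x -> A y -> rho x y = rho y x;
  ultrametric_max : forall x y z, A x -> A y -> A z ->
    rho x z <= Num.max (rho x y) (rho y z) }.

Section SelfSimilar.
Variables (R : realType) (B : stationary_bratteli).
Variables (alpha : R) (a : seq (level_edge B) -> R).

(* By convention this is also the diameter of the cylinder [gamma]. *)
Definition weight (t : seq (level_edge B)) : R := a t * alpha ^+ size t.

Record self_similar_ultrametric_cantor_set
    (rho : edge_sequence B -> edge_sequence B -> R) : Prop :=
  SelfSimilarUltrametricCantorSet {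
  ss_cantor : cantor_set (infinite_paths (B := B));
  ss_ultrametric : ultrametric_on (infinite_paths (B := B)) rho;
  ss_alpha : 0 < alpha < 1;
  ss_a_gt0 : forall t, finite_path t -> 0 < a t;
  ss_a_inf : (0 < ereal_inf [set (a t)%:E | t in finite_paths (B := B)])%E;
  ss_a_sup : (ereal_sup [set (a t)%:E | t in finite_paths (B := B)] < +oo)%E;
  ss_weight_noninc : forall t t', finite_path t -> finite_path t' ->
    prefix t t' -> weight t' <= weight t;
  ss_rhoE : forall x y t, infinite_paths x -> infinite_paths y -> x <> y ->
    longest_common_prefix x y t -> rho x y = a t * alpha ^+ size t }.

End SelfSimilar.

Section Zeta.
Variable R : realType.

(* [x] raised to the complex power [s], for a real x > 0: exp (s * ln x). *)
Definition cpow (x : R) (s : R[i]^o) : R[i]^o :=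
  let r := expR (complex.Re s * ln x) in
  let theta := complex.Im s * ln x in
  (r * cos theta) +i* (r * sin theta).

Definition zeta_term (B : stationary_bratteli) (alpha : R)
    (a : seq (level_edge B) -> R) (n : nat) (s : R[i]^o) : R[i]^o :=
  \sum_(t : n.-tuple (level_edge B) | finite_path t) cpow (weight alpha a t) s.

Definition holomorphic_on (U : set R[i]^o) (f : R[i]^o -> R[i]^o) : Prop :=
  forall z, U z -> derivable f z 1.

Definition half_plane (s0 : R) : set R[i]^o := [set s | s0 < complex.Re s].

Definition series_sum (u : nat -> R[i]^o -> R[i]^o) (s : R[i]^o) : R[i]^o :=
  limn (series (u ^~ s)).

Definition singular_at (f : R[i]^o -> R[i]^o) (s0 : R) : Prop :=
  ~ exists (U : set R[i]^o) (g : R[i]^o -> R[i]^o),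
      [/\ open U, U s0%:C, holomorphic_on U g &
          forall s, U s -> half_plane s0 s -> g s = f s].

Definition abscissa_of_convergence (u : nat -> R[i]^o -> R[i]^o) (s0 : R) :
    Prop :=
  [/\ 0 < s0,
      forall s, half_plane s0 s -> cvgn (series (u ^~ s)),
      holomorphic_on (half_plane s0) (series_sum u) &
      singular_at (series_sum u) s0].

End Zeta.

(* Main.v *)
Require Import Defs.
From mathcomp Require Import all_boot all_order all_algebra.
From mathcomp Require Import all_classical all_reals all_analysis.
From mathcomp.real_closed Require Import complex.
From mathcomp Require Import ring lra zify.

Set Implicit Arguments.
Unset Strict Implicit.
Unset Printing Implicit Defensive.

Import Order.TTheory GRing.Theory Num.Theory.
Import numFieldNormedType.Exports.

Local Open Scope classical_set_scope.
Local Open Scope ring_scope.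

(* Write N_n for the number of paths of length n, b = - log alpha and
   sigma = log Lambda / b.  The weights of the paths of length n lie between two
   constant multiples of exp (- b n), so zeta (s) is comparable to the sum of
   N_n exp (- b n s).  A left eigenvector for Lambda gives
   Lambda ^ n <= N_(n+1), and Cayley-Hamilton gives N_n = O (r ^ n) for every
   r > Lambda.  Hence zeta converges and can be differentiated term by term
   where Re s > sigma, while zeta (s) tends to +oo as s decreases to sigma along
   the reals, which excludes any continuous extension.  Finally sigma > 0,
   i.e. Lambda > 1: as no infinite path is isolated, every vertex that starts an
   infinite path starts two of them, so that the number of extendable paths
   doubles every K steps for some K. *)

(** * Counting paths *)

Lemma big_tuple_cons (V : Type) (idx : V) (op : Monoid.com_law idx)
    (T : finType) (n : nat) (P : pred (seq T)) (F : seq T -> V) :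
  \big[op/idx]_(t : n.+1.-tuple T | P t) F t =
  \big[op/idx]_(x : T) \big[op/idx]_(t : n.-tuple T | P (x :: t)) F (x :: t).
Proof.
rewrite pair_big_dep/=.
rewrite (reindex (fun p : T * n.-tuple T => cons_tuple p.1 p.2)) /=; last first.
  exists (fun t => (thead t, [tuple of behead t])) => [[x t] _|t _] /=.
    by rewrite theadE; congr pair; apply: val_inj.
  by rewrite [RHS]tuple_eta; apply: val_inj.
by apply: eq_big.
Qed.

Section Walks.
Variable B : stationary_bratteli.
Implicit Types (v : vertex B) (f : vertex B -> nat) (n : nat).

(** This is the [n]-th power of the adjacency matrix applied to the vector [f], kept in [nat]. The
    choice of [f] decides which walks count: all of them, those ending at one given vertex, or those
    ending at a live vertex. *)
Fixpoint walk_sum f n v : nat :=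
  if n is m.+1 then (\sum_(e : edge B | src e == v) walk_sum f m (rng e))%N
  else f v.

Lemma walk_sumD f m n v : walk_sum f (m + n) v = walk_sum (walk_sum f n) m v.
Proof. by elim: m v => //= m IH v; apply: eq_bigr => e _; rewrite IH. Qed.

Lemma leq_walk_sum f g n v : (forall u, f u <= g u)%N ->
  (walk_sum f n v <= walk_sum g n v)%N.
Proof. by move=> fg; elim: n v => //= n IH v; apply: leq_sum. Qed.

Lemma walk_sumZ k f n v :
  walk_sum (fun u => k * f u)%N n v = (k * walk_sum f n v)%N.
Proof.
by elim: n v => //= n IH v; rewrite big_distrr/=; apply: eq_bigr => e _.
Qed.

Lemma card_path (n : nat) (e : level_edge B) :
  (\sum_(t : n.-tuple (level_edge B) | path (@consecutive B) e t) 1)%N =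
  walk_sum (fun=> 1%N) n (range_of e).
Proof.
elim: n e => [|n IH] e.
  by rewrite (big_pred1 [tuple]) // => t; rewrite [t]tuple0; apply/esym/eqP.
rewrite (big_tuple_cons _ _ (path (@consecutive B) e) (fun=> 1%N)) /=.
rewrite big_sumType/= big1 ?add0n => [|v _]; last by rewrite big1.
rewrite [RHS]big_mkcond/=; apply: eq_bigr => f _.
by rewrite eq_sym; case: eqP => _ /=; [exact: (IH (inr f))|rewrite big1].
Qed.

Lemma card_finite_path (n : nat) :
  (\sum_(t : n.+1.-tuple (level_edge B) | finite_path t) 1)%N =
  (\sum_v walk_sum (fun=> 1%N) n v)%N.
Proof.
rewrite (big_tuple_cons _ _ (@finite_path B) (fun=> 1%N)) /=.
rewrite big_sumType/= [X in (_ + X)%N]big1 ?addn0 => [|e _]; last by rewrite big1.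
by apply: eq_bigr => v _; exact: (card_path n (inl v)).
Qed.

Lemma card_finite_path0 :
  (\sum_(t : 0.-tuple (level_edge B) | finite_path t) 1)%N = 1%N.
Proof. by rewrite (big_pred1 [tuple]) // => t; rewrite [t]tuple0; apply/esym/eqP. Qed.

Lemma adjacency_matrix_exp (F : pzRingType) n f :
  adjacency_matrix F B ^+ n *m \col_i (f (enum_val i))%:R =
  \col_i (walk_sum f n (enum_val i))%:R.
Proof.
elim: n => [|n IH]; first by rewrite expr0 mul1mx.
rewrite exprS -[_ * _]/(_ *m _) -mulmxA IH; apply/colP => i; rewrite !mxE /=.
under eq_bigr do rewrite !mxE -natrM.
rewrite -natr_sum; congr (_%:R).
(* The edges leaving a vertex are grouped by their range; each group has as many elements as the
   matrix entry says. *)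
rewrite (partition_big (fun e => enum_rank (rng e)) predT) //=.
apply: eq_bigr => j _.
rewrite -[X in (X * _)%N]sum1_card big_distrl /=.
apply: eq_big => [e|e /set_mem/andP[_ /eqP <-]]; last by rewrite mul1n.
have -> : (enum_rank (rng e) == j) = (rng e == enum_val j).
  by rewrite -(can_eq (@enum_rankK _)) enum_valK.
by apply/idP/idP => [/set_mem|?]; last exact/mem_set.
Qed.

End Walks.

(** * Growth of the entries of matrix powers *)

Section Growth.
Variable F : numClosedFieldType.

(** The constant c' = |x 0| + c / (r - |mu|) satisfies c + |mu| c' <= r c', which is exactly what
    the induction step asks for. *)
Lemma affine_recurrence_bound (x : nat -> F) (mu r c : F) : `|mu| < r ->
  (forall k, `|x k.+1 - mu * x k| <= c * r ^+ k) ->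
  exists c', forall k, `|x k| <= c' * r ^+ k.
Proof.
move=> mu_r xP; have d_gt0 : 0 < r - `|mu| by rewrite subr_gt0.
have r_gt0 : 0 < r by exact: le_lt_trans mu_r.
have c_ge0 : 0 <= c by rewrite -[c]mulr1 -(expr0 r); apply: le_trans (xP 0%N).
exists (`|x 0%N| + c / (r - `|mu|)); elim=> [|k IH].
  by rewrite expr0 mulr1 lerDl divr_ge0// ltW.
rewrite -[x k.+1](subrK (mu * x k)).
apply: le_trans (ler_normD _ _) _; rewrite normrM.
apply: le_trans (lerD (xP k) (ler_wpM2l (normr_ge0 mu) IH)) _.
rewrite exprS [`|mu| * _]mulrA -mulrDl mulrA.
apply: ler_wpM2r; first by rewrite exprn_ge0// ltW.
rewrite -lerBrDr [_ * r]mulrC -mulrBl mulrDr [X in _ + X]mulrC divfK ?gt_eqF//.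
by rewrite lerDr mulr_ge0// ltW.
Qed.

(** The factors of the annihilating product are removed one at a time, with a free right factor [P]
    to carry the induction. For Q the remaining product times [P], A^k (A - z) Q = A^(k+1) Q - z A^k
    Q, so each entry of A^k Q obeys an affine recurrence with multiplier z. *)
Lemma annihilated_matrix_exp_bound n (A : 'M[F]_n.+1) (s : seq F) (r : F) :
  {in s, forall mu, `|mu| < r} -> \prod_(z <- s) (A - z%:M) = 0 ->
  0 < r -> forall i j, exists c, forall k, `|(A ^+ k) i j| <= c * r ^+ k.
Proof.
move=> s_r s0 r_gt0.
suff: forall P : 'M[F]_n.+1,
    (forall i j, exists c, forall k,
      `|(A ^+ k * ((\prod_(z <- s) (A - z%:M)) * P)) i j| <= c * r ^+ k) ->
    forall i j, exists c, forall k, `|(A ^+ k * P) i j| <= c * r ^+ k.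
  move=> /(_ 1) H i j; have [//|c cP] := H _ i j.
    by move=> {}i {}j; exists 0 => k; rewrite s0 mul0r mulr0 mxE normr0 mul0r.
  by exists c => k; rewrite -[A ^+ k]mulr1.
elim: s s_r {s0} => [|z s IH] s_r P HP i j.
  by have [c cP] := HP i j; exists c => k; have := cP k; rewrite big_nil mul1r.
apply: IH => [mu mus|{}i {}j]; first by rewrite s_r// inE mus orbT.
have [c cP] := HP i j.
apply: (affine_recurrence_bound (s_r z (mem_head _ _)) (c := c)) => k.
apply: le_trans (cP k); rewrite big_cons -mulrA.
set Q := (\prod_(_ <- _) _) * P.
have -> : A ^+ k * ((A - z%:M) * Q) = A ^+ k.+1 * Q - z *: (A ^+ k * Q).
  by rewrite mulrBl mulrBr mulrA -exprSr [z%:M * Q]mul_scalar_mx -scalerAr.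
by rewrite !mxE.
Qed.

(* Cayley-Hamilton, peeling off one root of the characteristic polynomial at a
   time. *)
Lemma matrix_exp_bound n (A : 'M[F]_n) (r : F) : 0 < r ->
  (forall mu, eigenvalue A mu -> `|mu| < r) ->
  forall i j, exists c, forall k, `|(A ^+ k) i j| <= c * r ^+ k.
Proof.
case: n A => [|n] A r_gt0 Ar; first by case.
have [s sP] := closed_field_poly_normal (char_poly A).
rewrite (monicP (char_poly_monic A)) scale1r in sP.
apply: (@annihilated_matrix_exp_bound n A s) => //.
  by move=> mu mus; apply: Ar; rewrite eigenvalue_root_char sP root_prod_XsubC.
rewrite -(Cayley_Hamilton A) sP rmorph_prod; apply: eq_bigr => z _.
by rewrite rmorphB /= horner_mx_X horner_mx_C.
Qed.

End Growth.

(** * Two-sided growth bounds for the number of paths *)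

Definition num_paths (B : stationary_bratteli) (n : nat) : nat :=
  (\sum_(t : n.-tuple (level_edge B) | finite_path t) 1)%N.

Section NumPaths.
Variables (R : realType) (B : stationary_bratteli) (Lambda : R).
Hypothesis HL : perron_frobenius_eigenvalue B Lambda.

Lemma num_pathsS n :
  num_paths B n.+1 = (\sum_i walk_sum (fun=> 1%N) n (@enum_val _ (vertex B) i))%N.
Proof.
rewrite /num_paths card_finite_path (reindex (@enum_val _ (vertex B)))//.
by exists enum_rank => [i _|v _]; rewrite (enum_rankK, enum_valK).
Qed.

(** Compare the coordinates of v A^n = Lambda^n v at an index j where |v_j| is largest: column j of
    A^n counts the walks ending at j, so Lambda^n |v_j| is at most |v_j| times the number of all
    walks of length n. The root edge accounts for the index n + 1. *)
Lemma num_paths_ge n : Lambda ^+ n <= (num_paths B n.+1)%:R.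
Proof.
have [L_ge0 /eigenvalueP [v vA v_neq0] _] := HL.
set A := adjacency_matrix _ _ in vA.
have [i0 vi0] : exists i, v 0 i != 0 by apply/rV0Pn.
have [j _ jmax] := arg_maxP (fun i => complex.Re `|v 0 i|) (erefl : xpredT i0).
have vmax i : `|v 0 i| <= `|v 0 j|.
  by have := jmax i isT; rewrite !normc_def /= lecR.
have vj : 0 < `|v 0 j|.
  by apply: lt_le_trans (vmax i0); rewrite normr_gt0.
have vAn : v *m A ^+ n = Lambda%:C%C ^+ n *: v.
  elim: n => [|n IH]; first by rewrite !expr0 mulmx1 scale1r.
  by rewrite exprSr [A ^+ n * A]/(_ *m _) mulmxA IH -scalemxAl vA scalerA -exprSr.
pose f (u : vertex B) : nat := u == enum_val j.
have /(congr1 (fun M => (v *m M) 0 0)) := adjacency_matrix_exp R[i] n f.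
have -> : \col_i (f (enum_val i))%:R = delta_mx j 0 :> 'cV[R[i]]_ _.
  by apply/colP => i; rewrite !mxE /f (can_eq (@enum_valK _)) andbT.
rewrite mulmxA vAn mxE (bigD1 j)//= big1 ?addr0; last first.
  by move=> i /negPf ij; rewrite !mxE ij mulr0.
rewrite !mxE !eqxx mulr1 => E.
rewrite -lecR rmorphXn/= -(ler_pM2r vj).
rewrite -[X in X * _]ger0_norm ?exprn_ge0 ?ler0c// -normrM E.
apply: le_trans (ler_norm_sum _ _ _) _.
rewrite rmorph_nat num_pathsS natr_sum mulr_suml; apply: ler_sum => i _.
rewrite mxE normrM normr_nat mulrC ler_pM// ler_nat.
by apply: leq_walk_sum => u; rewrite /f; case: eqP.
Qed.

Lemma num_paths_le r : Lambda < r ->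
  exists2 C, 0 < C & forall n, (num_paths B n)%:R <= C * r ^+ n.
Proof.
have [L_ge0 _ Lmax] := HL => Lr.
have r_gt0 : 0 < r by exact: le_lt_trans Lr.
have [|c cP] :=
    @choice _ _ (fun ij : 'I_#|vertex B| * 'I_#|vertex B| => fun c : R[i] => forall k,
    `|(adjacency_matrix R[i] B ^+ k) ij.1 ij.2| <= c * r%:C%C ^+ k).
  move=> ij; apply: matrix_exp_bound; first by rewrite ltcR.
  by move=> mu /Lmax mu_L; apply: le_lt_trans mu_L _; rewrite ltcR.
pose C := \sum_ij complex.Re (c ij).
have c_ge0 ij : 0 <= c ij.
  by rewrite -[c ij]mulr1 -(expr0 r%:C%C); apply: le_trans (cP ij 0%N).
have cE ij : c ij = (complex.Re (c ij))%:C%C.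
  by rewrite RRe_real// ger0_real.
have C_ge0 : 0 <= C.
  by apply: sumr_ge0 => ij _; have := c_ge0 ij; rewrite {1}cE ler0c.
have NP n : (num_paths B n.+1)%:R <= C * r ^+ n.
  rewrite -lecR rmorph_nat rmorphM rmorphXn /=.
  have -> : C%:C%C = \sum_ij (complex.Re (c ij))%:C%C by rewrite rmorph_sum.
  rewrite mulr_suml.
  rewrite num_pathsS natr_sum.
  have -> : \sum_ij (complex.Re (c ij))%:C%C * r%:C%C ^+ n =
      \sum_i \sum_j (complex.Re (c (i, j)))%:C%C * r%:C%C ^+ n.
    by rewrite pair_bigA; apply: eq_bigr => -[].
  apply: ler_sum => i _.
  have /(congr1 (fun M : 'cV[R[i]]_#|vertex B| => `|M i 0|)) :=
    adjacency_matrix_exp R[i] n (fun _ : vertex B => 1%N).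
  rewrite !mxE normr_nat => <-; apply: le_trans (ler_norm_sum _ _ _) _.
  by apply: ler_sum => j _; rewrite mxE mulr1 -cE; exact: (cP (i, j)).
(* The summand 1 covers the empty path, and the division by r the shift from n + 1 to n in [NP]. *)
exists (1 + C / r) => [|[|n]]; first by rewrite ltr_pwDl// divr_ge0// ltW.
  by rewrite /num_paths card_finite_path0 expr0 mulr1 lerDl divr_ge0// ltW.
apply: le_trans (NP n) _; rewrite exprS mulrA mulrDl divfK ?gt_eqF//.
apply: ler_wpM2r; first by rewrite exprn_ge0// ltW.
by rewrite mul1r lerDr ltW.
Qed.

End NumPaths.

(** * Branching of infinite paths, and Lambda > 1 *)

Section LiveVertices.
Variable B : stationary_bratteli.
Implicit Types (x y : edge_sequence B) (v : vertex B).

(** The absence of isolated paths says nothing about vertices that start no infinite path, so the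
    lower bound counts only walks that end at a live vertex. *)
Definition live v := exists2 x, infinite_paths x & x 0%N = inl v.

Definition live_count v : nat := `[< live v >].

(** By stationarity, a path can be restarted one level later: its first two edges are replaced by
    the root edge to the vertex they lead to. *)
Definition shift_path x : edge_sequence B :=
  fun j => if j is k.+1 then x k.+2 else inl (range_of (x 1%N)).

Lemma infinite_paths_shift x : infinite_paths x -> infinite_paths (shift_path x).
Proof.
move=> [x0 xj]; split=> // -[|j] /=; last exact: xj.
by have := xj 1%N; rewrite /consecutive; case: (x 2%N).
Qed.

Lemma infinite_paths_edge1 x v : infinite_paths x -> x 0%N = inl v ->
  exists2 e, x 1%N = inr e & src e = v.
Proof.
by move=> [_ /(_ 0%N)] + x0; rewrite x0 /=; case: (x 1%N) => //= e /eqP ->; exists e.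
Qed.

Lemma live_rng x v e : infinite_paths x -> x 1%N = inr e -> live (rng e).
Proof.
move=> xP x1; exists (shift_path x); first exact: infinite_paths_shift.
by rewrite /shift_path x1.
Qed.

Lemma live_countE v : live v -> live_count v = 1%N.
Proof. by rewrite /live_count => /asboolT ->. Qed.

(** A walk ending at a live vertex can be continued by the next edge of an infinite path, and again
    ends at a live vertex. *)
Lemma live_count_mono n v :
  (walk_sum live_count n v <= walk_sum live_count n.+1 v)%N.
Proof.
elim: n v => [|n IH] v; last by apply: leq_sum.
rewrite /= {1}/live_count; case: asboolP => // -[x xP x0].
have [e x1 ev] := infinite_paths_edge1 xP x0.
by rewrite (bigD1 e) ?ev//= live_countE//; exact: live_rng xP x1.
Qed.

(** If the first edges after the root differ, each of them contributes a walk; if they agree, both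
    paths are shifted and the induction continues from the common next vertex. *)
Lemma live_count_ge2 m x y v : infinite_paths x -> infinite_paths y ->
  x 0%N = inl v -> y 0%N = inl v -> x m <> y m ->
  (1 < walk_sum live_count m v)%N.
Proof.
elim: m x y v => [|m IH] x y v xP yP x0 y0 xy; first by rewrite x0 y0 in xy.
have [e x1 ev] := infinite_paths_edge1 xP x0.
have [f y1 fv] := infinite_paths_edge1 yP y0.
have pos z g n : infinite_paths z -> z 1%N = inr g ->
    (0 < walk_sum live_count n (rng g))%N.
  move=> zP z1; elim: n => [|n IHn]; last exact: leq_trans IHn (live_count_mono _ _).
  by rewrite /= live_countE//; exact: live_rng zP z1.
have [ef|/eqP ef] := eqVneq e f; last first.
  rewrite /= (bigD1 e) ?ev//= (bigD1 f) ?fv//=; last by rewrite eqxx eq_sym; exact/eqP.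
  by have := pos _ _ m xP x1; have := pos _ _ m yP y1; lia.
case: m xy IH => [|m] xy IH; first by rewrite x1 y1 ef in xy.
have IHe : (1 < walk_sum live_count m.+1 (rng e))%N.
  apply: (IH (shift_path x) (shift_path y)) => //; try exact: infinite_paths_shift.
    by rewrite /shift_path x1.
  by rewrite /shift_path y1 ef.
rewrite [walk_sum _ _ _]/= (bigD1 e) ?ev//.
exact: leq_trans IHe (leq_addr _ _).
Qed.

(** Otherwise [x] would be the only infinite path with its root edge, and fixing one coordinate is
    an open condition, so [x] would be isolated. *)
Lemma infinite_paths_branch x v : isolated (infinite_paths (B := B)) = set0 ->
  infinite_paths x -> x 0%N = inl v ->
  exists y m, [/\ infinite_paths y, y 0%N = inl v & x m <> y m].
Proof.
move=> iso0 xP x0; apply: contrapT => H.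
suff : isolated (infinite_paths (B := B)) x by rewrite iso0.
split; first exact/mem_set.
exists [set y : edge_sequence B | y 0%N = x 0%N].
  have := @proj_continuous nat (fun=> discrete_topology (level_edge B)) 0%N x.
  by move=> /(_ [set x 0%N]); apply; exact: discrete_set1.
apply/seteqP; split=> y /=; last by move=> ->.
move=> [y0 yP]; apply/esym/funext => m; apply: contrapT => xy.
by apply: H; exists y, m; split => //; rewrite y0.
Qed.

Lemma num_paths_exponential : cantor_set (infinite_paths (B := B)) ->
  exists K, forall j, (2 ^ j <= num_paths B (j * K).+1)%N.
Proof.
move=> [[x0 x0P] _ _ iso0].
have [|m mP] := @choice _ _
    (fun v k => live v -> (1 < walk_sum live_count k v)%N).
  move=> v; have [[x xP xv]|?] := pselect (live v); last by exists 0%N.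
  have [y [m [yP yv xy]]] := infinite_paths_branch iso0 xP xv.
  by exists m => _; exact: live_count_ge2 xP yP xv yv xy.
(* By monotonicity in the length, the largest of the branching lengths works for all live vertices
   at once; concatenating j blocks of length [K] then gives the factor 2^j. *)
exists (\max_v m v)%N; set K := (\max_v m v)%N => j.
have mono n k v :
    (walk_sum live_count n v <= walk_sum live_count (n + k) v)%N.
  elim: k => [|k IH]; first by rewrite addn0.
  by rewrite addnS; apply: leq_trans IH (live_count_mono _ _).
have KP v : (2 * live_count v <= walk_sum live_count K v)%N.
  rewrite {1}/live_count; case: asboolP => // lv; rewrite muln1.
  have mK : (m v <= K)%N by exact: leq_bigmax.
  by rewrite -(subnKC mK); apply: leq_trans (mP _ lv) (mono _ _ _).
have jP v : (2 ^ j * live_count v <= walk_sum live_count (j * K) v)%N.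
  elim: j v => [|j IH] v; first by rewrite mul1n.
  rewrite mulSn walk_sumD expnS -mulnA.
  apply: leq_trans (leq_walk_sum _ _ IH).
  by rewrite walk_sumZ mulnCA leq_mul2l KP orbT.
have [v x0v] : exists v, x0 0%N = inl v.
  by have [+ _] := x0P; case: (x0 0%N) => // v; exists v.
have lv : live v by exists x0.
have := jP v; rewrite live_countE// muln1 => /leq_trans; apply.
rewrite /num_paths card_finite_path (bigD1 v)//=.
apply: leq_trans (leq_addr _ _); apply: leq_walk_sum => u.
by rewrite /live_count; case: asbool.
Qed.

End LiveVertices.

(** If Lambda <= 1, every ratio r > 1 bounds the path counts. Take r with r^(K+1) = sqrt 2, where K
    + 1 avoids dividing by zero. With h = ln 2 / 2 this gives exp (2 j h) <= C r exp (j h) for all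
    j, which fails once j h > C r. *)
Lemma perron_frobenius_gt1 (R : realType) (B : stationary_bratteli) (Lambda : R) :
  cantor_set (infinite_paths (B := B)) ->
  perron_frobenius_eigenvalue B Lambda -> 1 < Lambda.
Proof.
move=> /num_paths_exponential [K KP] HL; rewrite ltNge; apply/negP => L_le1.
pose r : R := expR (K.+1%:R^-1 * (ln 2 / 2)).
have ln2 : 0 < ln 2 :> R by rewrite ln_gt0// ltr1n.
have r_gt1 : 1 < r by rewrite expR_gt1 mulr_gt0// ?invr_gt0 ?divr_gt0.
have [C C_gt0 CP] := num_paths_le HL (le_lt_trans L_le1 r_gt1).
set h := ln 2 / 2 in r r_gt1 CP *.
have h_gt0 : 0 < h by rewrite divr_gt0.
have Cr_gt0 : 0 < C * r by rewrite mulr_gt0// (lt_trans ltr01).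
have := archi_boundP (ltW (divr_gt0 Cr_gt0 h_gt0)).
set j := Num.bound _; rewrite ltr_pdivrMr// => jP.
have : (2 ^ j)%:R <= C * r * expR (j%:R * h).
  apply: le_trans (_ : (num_paths B (j * K).+1)%:R <= _); first by rewrite ler_nat.
  apply: le_trans (CP _) _; rewrite exprS mulrA ler_pM2l//.
  rewrite -expRM_natl ler_expR natrM -mulrA ler_wpM2l// mulrA ler_piMl ?(ltW h_gt0)//.
  by rewrite ler_pdivrMr ?ltr0n// mul1r ler_nat.
have two_pos : (2 : R) \is Num.pos by rewrite posrE.
apply/negP; rewrite -ltNge natrX -[X in _ < X ^+ _](lnK two_pos).
have -> : ln 2 = h + h by rewrite /h -splitr.
rewrite -expRM_natl mulrDr expRD ltr_pM2r ?expR_gt0//.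
by apply: lt_trans jP _; apply: lt_le_trans (expR_ge1Dx _); rewrite ltrDr.
Qed.

Local Open Scope complex_scope.

(** * Complex powers and termwise differentiation *)

Section ElementaryBounds.
Variable R : realType.
Implicit Types x u v : R.

(** Each Taylor estimate below uses this once, bounding the derivative at the intermediate point by
    a standard bound or an earlier estimate; |c| <= |x| treats both signs of x together. *)
Lemma mean_value_from0 (f df : R -> R) x :
  (forall y : R, is_derive y 1 f (df y)) ->
  exists2 c, `|c| <= `|x| & f x - f 0 = df c * x.
Proof.
move=> fd; have fc (D : set R) : {within D, continuous f}.
  by apply: continuous_subspaceT => y; apply/differentiable_continuous/derivable1_diffP.
have [x0|x0] := leP 0 x.
  have [c + E] := MVT_segment x0 (fun y _ => fd y) (fc _).
  rewrite in_itv/= => /andP[c0 cx]; exists c; last by rewrite E subr0.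
  by rewrite !ger0_norm.
have [c + E] := MVT_segment (ltW x0) (fun y _ => fd y) (fc _).
rewrite in_itv/= => /andP[cx c0]; exists c; last by rewrite -opprB E; ring.
by rewrite (ler0_norm c0) (ltr0_norm x0) lerN2.
Qed.

Lemma norm_sin_le x : `|sin x| <= `|x|.
Proof.
have [c _] := mean_value_from0 x (@is_derive_sin R).
by rewrite sin0 subr0 => ->; rewrite normrM ler_piMl// cos_max.
Qed.

Lemma norm_cosB1_le x : `|cos x - 1| <= `|x| ^+ 2.
Proof.
have [c cx] := mean_value_from0 x (@is_derive_cos R).
rewrite cos0 => ->; rewrite normrM normrN expr2 ler_wpM2r//.
exact: le_trans (norm_sin_le c) cx.
Qed.

Lemma norm_cosB1_le1 x : `|cos x - 1| <= `|x|.
Proof.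
have [c cx] := mean_value_from0 x (@is_derive_cos R).
by rewrite cos0 => ->; rewrite normrM normrN ler_piMl// sin_max.
Qed.

Lemma norm_sinB_le x : `|sin x - x| <= `|x| ^+ 2.
Proof.
have [c cx] := mean_value_from0 x (@is_derive_sin R).
rewrite sin0 subr0 => ->; rewrite -[X in _ - X]mul1r -mulrBl normrM expr2 ler_wpM2r//.
exact: le_trans (norm_cosB1_le1 c) cx.
Qed.

Lemma norm_expRB1_le x : `|expR x - 1| <= `|x| * expR `|x|.
Proof.
have [c cx] := mean_value_from0 x (@is_derive_expR R).
rewrite expR0 => ->; rewrite normrM mulrC ler_wpM2l// ger0_norm ?expR_ge0//.
by rewrite ler_expR (le_trans (ler_norm c)).
Qed.

Lemma norm_expRB1B_le x : `|expR x - 1 - x| <= `|x| ^+ 2 * expR `|x|.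
Proof.
have [c cx] := mean_value_from0 x (@is_derive_expR R).
rewrite expR0 => ->; rewrite -[X in _ - X]mul1r -mulrBl normrM mulrC expr2 -mulrA.
rewrite ler_wpM2l//; apply: le_trans (norm_expRB1_le c) _.
by rewrite ler_pM ?expR_ge0// ler_expR.
Qed.

(** Lets the logarithm produced by differentiating a power be absorbed by a small change of
    exponent. *)
Lemma norm_le_expR (d x : R) : 0 < d -> `|x| <= d^-1 * expR (d * `|x|).
Proof.
move=> d0; rewrite -ler_pdivrMl ?invr_gt0// invrK.
by apply: le_trans (expR_ge1Dx _); rewrite lerDr.
Qed.

End ElementaryBounds.

(** * Moduli and limits through real and imaginary parts *)

Section ComplexL1Norm.
Variable R : realType.
Implicit Types z w : R[i].

(* A real-valued norm equivalent to the [R[i]]-valued modulus. *)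
Definition norm1 z : R := `|complex.Re z| + `|complex.Im z|.

Lemma ReD z w : complex.Re (z + w) = complex.Re z + complex.Re w.
Proof. by case: z w => [a b] [c d]. Qed.

Lemma ImD z w : complex.Im (z + w) = complex.Im z + complex.Im w.
Proof. by case: z w => [a b] [c d]. Qed.

Lemma norm1_ge0 z : 0 <= norm1 z.
Proof. by rewrite addr_ge0. Qed.

Lemma norm1_0 : norm1 0 = 0.
Proof. by rewrite /norm1 /= normr0 addr0. Qed.

Lemma norm1D z w : norm1 (z + w) <= norm1 z + norm1 w.
Proof.
by rewrite /norm1 ReD ImD addrACA lerD// ler_normD.
Qed.

Lemma norm1_sum (I : finType) (P : pred I) (F : I -> R[i]) :
  norm1 (\sum_(i | P i) F i) <= \sum_(i | P i) norm1 (F i).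
Proof.
elim/big_ind2: _ => [|x a y b xa yb|//]; first by rewrite norm1_0.
exact: le_trans (norm1D _ _) (lerD xa yb).
Qed.

Lemma norm1M z w : norm1 (z * w) <= norm1 z * norm1 w.
Proof.
case: z w => [a b] [c d]; rewrite /norm1 /=.
apply: le_trans (lerD (ler_normB _ _) (ler_normD _ _)) _.
by rewrite !normrM; nra.
Qed.

Lemma norm1R (x : R) : norm1 x%:C = `|x|.
Proof. by rewrite /norm1 /= normr0 addr0. Qed.

Lemma norm_le_norm1 z : `|z| <= (norm1 z)%:C.
Proof.
rewrite normc_def lecR -[leRHS]ger0_norm ?norm1_ge0// -sqrtr_sqr.
rewrite ler_sqrt ?sqr_ge0//.
rewrite /norm1 sqrrD !real_normK ?num_real//.
by rewrite lerD2r lerDl mulrn_wge0 ?mulr_ge0.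
Qed.

Lemma normc_ge_Im z : `|complex.Im z|%:C <= `|z|.
Proof.
by rewrite normc_def lecR -sqrtr_sqr ler_sqrt ?addr_ge0 ?sqr_ge0// lerDr sqr_ge0.
Qed.

Lemma norm1_le_norm z : (norm1 z)%:C <= `|z| *+ 2.
Proof. by rewrite rmorphD mulr2n lerD ?normc_ge_Re ?normc_ge_Im. Qed.

Lemma gt0_complex (e : R[i]) : 0 < e -> exists2 r : R, 0 < r & e = r%:C.
Proof.
move=> e0; exists (complex.Re e); last by rewrite RRe_real// gtr0_real.
by move: e0; rewrite ltcE => /andP[].
Qed.

End ComplexL1Norm.

Section ComplexLimits.
Variable R : realType.
Context {T : Type} {F : set_system T} {FF : Filter F}.
Implicit Types (f : T -> R[i]^o) (l : R[i]^o).

Lemma cvg_complex f l :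
  complex.Re (f x) @[x --> F] --> complex.Re l ->
  complex.Im (f x) @[x --> F] --> complex.Im l -> f x @[x --> F] --> l.
Proof.
move=> /cvgrPdist_lt fR /cvgrPdist_lt fI; apply/cvgrPdist_lt => e /gt0_complex[r r0 ->].
have r2 : 0 < r / 2 by rewrite divr_gt0.
near=> x; apply: le_lt_trans (norm_le_norm1 _) _; rewrite ltcR [r]splitr.
rewrite /norm1 !raddfB/=; apply: ltrD; near: x; [exact: fR|exact: fI].
Unshelve. all: by end_near. Qed.

Lemma cvg_Re f l : f x @[x --> F] --> l ->
  complex.Re (f x) @[x --> F] --> complex.Re l.
Proof.
move=> /cvgrPdist_lt fl; apply/cvgrPdist_lt => e e0.
have eC : 0 < e%:C :> R[i] by rewrite ltcR.
have := fl _ eC; apply: filterS => x; rewrite -ltcR; apply: le_lt_trans.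
by rewrite -raddfB; exact: normc_ge_Re.
Qed.

End ComplexLimits.

Section Cpow.
Variable R : realType.
Implicit Types (x : R) (s h : R[i]).

Lemma cpowD x s h : cpow x (s + h) = cpow x s * cpow x h.
Proof.
case: s h => [a b] [c d]; rewrite /cpow /= !mulrDl expRD cosD sinD.
by apply/eqP; rewrite eq_complex /=; apply/andP; split; apply/eqP; ring.
Qed.

Lemma norm1_cpow x s : norm1 (cpow x s) <= 2 * expR (complex.Re s * ln x).
Proof.
rewrite /norm1 /= !normrM (ger0_norm (expR_ge0 _)) -mulrDr [2 * _]mulrC.
by rewrite ler_pM2l ?expR_gt0// -[2]/(1 + 1) lerD ?cos_max ?sin_max.
Qed.

(** Second-order remainder of exp (h ln x). With u and v the real and imaginary parts of h ln x,
    both components are split so that each piece is a product of one-variable remainders. *)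
Lemma norm1_cpowB1B x h :
  norm1 (cpow x h - 1 - h * (ln x)%:C) <=
  2 * (norm1 h * `|ln x|) ^+ 2 * expR (norm1 h * `|ln x|).
Proof.
case: h => a b; rewrite /norm1 /cpow /= !mulr0 subr0 add0r subr0.
set u := a * ln x; set v := b * ln x.
have -> : (`|a| + `|b|) * `|ln x| = `|u| + `|v| by rewrite mulrDl -!normrM.
have -> : expR u * cos v - 1 - u = (expR u - 1 - u) + expR u * (cos v - 1) by ring.
have -> : expR u * sin v - v = (expR u - 1) * sin v + (sin v - v) by ring.
have Eu : expR u <= expR `|u| by rewrite ler_expR ler_norm.
have Eu1 : 1 <= expR `|u| by rewrite -expR0 ler_expR.
have h1 : `|expR u - 1 - u + expR u * (cos v - 1)| <=
    `|u| ^+ 2 * expR `|u| + expR `|u| * `|v| ^+ 2.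
  apply: le_trans (ler_normD _ _) (lerD (norm_expRB1B_le u) _).
  by rewrite normrM ger0_norm ?expR_ge0// ler_pM ?expR_ge0// norm_cosB1_le.
have h2 : `|(expR u - 1) * sin v + (sin v - v)| <=
    `|u| * expR `|u| * `|v| + expR `|u| * `|v| ^+ 2.
  apply: le_trans (ler_normD _ _) (lerD _ _).
    by rewrite normrM ler_pM ?norm_expRB1_le ?norm_sin_le.
  by apply: le_trans (norm_sinB_le v) _; rewrite ler_peMl// sqr_ge0.
apply: le_trans (lerD h1 h2) _.
apply: (@le_trans _ _ (2 * (`|u| + `|v|) ^+ 2 * expR `|u|)).
  rewrite -subr_ge0.
  rewrite (_ : _ - _ = expR `|u| * (`|u| ^+ 2 + 3 * (`|u| * `|v|))); last by ring.
  by rewrite mulr_ge0 ?expR_ge0// addr_ge0 ?sqr_ge0// !mulr_ge0.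
by rewrite ler_wpM2l ?mulr_ge0 ?sqr_ge0// ler_expR lerDl.
Qed.

End Cpow.

(** * Series with a geometric majorant *)

Section GeometricSeries.
Variable R : realType.
Implicit Types (K q : R).

Lemma cvg_series_geometric_bound (u : nat -> R) K q : 0 <= q < 1 ->
  (forall n, `|u n| <= K * q ^+ n) ->
  cvgn (series u) /\ `|limn (series u)| <= K / (1 - q).
Proof.
move=> /andP[q0 q1] uP; have q1' : `|q| < 1 by rewrite ger0_norm.
have cg := @cvg_geometric_series R K q q1'.
have cn : cvgn [normed series u].
  apply: series_le_cvg (@is_cvg_geometric_series R K q q1') => n //=.
  exact: le_trans (uP n).
have cu := normed_cvg cn; split => //.
apply: le_trans (lim_series_norm cn) _.
rewrite -(cvg_lim _ cg)//; apply: lim_series_le => //.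
exact: is_cvg_geometric_series.
Qed.

Lemma cvg_complex_series_geometric_bound (u : nat -> R[i]^o) K q : 0 <= q < 1 ->
  (forall n, norm1 (u n) <= K * q ^+ n) ->
  exists2 S : R[i]^o, series u @ \oo --> S & norm1 S <= 2 * (K / (1 - q)).
Proof.
move=> q01 uP.
have [|cR bR] := @cvg_series_geometric_bound (fun n => complex.Re (u n)) K q q01.
  by move=> n; apply: le_trans (uP n); rewrite lerDl.
have [|cI bI] := @cvg_series_geometric_bound (fun n => complex.Im (u n)) K q q01.
  by move=> n; apply: le_trans (uP n); rewrite lerDr.
exists (limn (series (fun n => complex.Re (u n))) +i*
        limn (series (fun n => complex.Im (u n)))); last first.
  by rewrite /norm1 mulr2n mulrDl mul1r lerD.
apply: cvg_complex => /=.
  by under eq_fun do rewrite raddf_sum.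
by under eq_fun do rewrite raddf_sum.
Qed.

(* Termwise differentiation: the remainders of the terms are bounded by
   [norm1 h ^+ 2] times the general term of one convergent series. *)
Lemma derivable_series_sum (u : nat -> R[i]^o -> R[i]^o) (d : nat -> R[i]^o)
    (z : R[i]^o) (delta K q : R) : 0 < delta -> 0 <= q < 1 ->
  (forall n, norm1 (u n z) <= K * q ^+ n) ->
  (forall n, norm1 (d n) <= K * q ^+ n) ->
  (forall h, norm1 h <= delta -> forall n,
    norm1 (u n (h + z) - u n z - h * d n) <= norm1 h ^+ 2 * (K * q ^+ n)) ->
  derivable (series_sum u) z 1.
Proof.
move=> delta0 q01 uzP dP uP.
have [fz fzP _] := cvg_complex_series_geometric_bound q01 uzP.
have [D DP _] := cvg_complex_series_geometric_bound q01 dP.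
pose M := 2 * (K / (1 - q)).
have M0 : 0 <= M.
  have K0 : 0 <= K by rewrite -[K]mulr1 -(expr0 q);
    apply: le_trans (uzP 0%N); rewrite norm1_ge0.
  by case/andP: q01 => q0 q1; rewrite mulr_ge0// divr_ge0// subr_ge0 ltW.
have rem h : norm1 h <= delta ->
    norm1 (series_sum u (h + z) - series_sum u z - h * D) <= norm1 h ^+ 2 * M.
  move=> hd; pose w n := u n (h + z) - u n z - h * d n.
  have [|S SP SM] := @cvg_complex_series_geometric_bound w (norm1 h ^+ 2 * K) q q01.
    by move=> n; rewrite -mulrA; exact: uP.
  (* Convergence at h + z is not assumed: the series there is the sum of the remainder series, the
     series at z and h times the series of derivatives. *)
  have cu : series (u ^~ (h + z)) @ \oo --> S + fz + h * D.
    rewrite (_ : series _ = (fun n => series w n + series (u ^~ z) n + h * series d n)).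
      exact: (cvgD (cvgD SP fzP) (cvgZl_tmp (V := R[i]^o) DP)).
    apply/funext => n; rewrite /series/= mulr_sumr -!big_split/=.
    by apply: eq_bigr => k _; rewrite /w; ring.
  rewrite /series_sum (cvg_lim (@norm_hausdorff _ R[i]^o) cu).
  rewrite (cvg_lim (@norm_hausdorff _ R[i]^o) fzP).
  rewrite (_ : _ - _ = S); last by ring.
  by apply: le_trans SM _; rewrite /M -(mulrA (norm1 h ^+ 2)) mulrCA.
apply/cvg_ex; exists D; apply/cvgrPdist_le => e /gt0_complex[r r0 ->].
have e1 : 0 < (delta / 2)%:C :> R[i] by rewrite ltcR divr_gt0.
(* Since norm1 h <= 2 |h|, the remainder is at most 4 M |h|^2, and this threshold makes it at most r
   |h|; M + 1 keeps the denominator positive. *)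
have e2 : 0 < (r / (4 * (M + 1)))%:C :> R[i].
  by rewrite ltcR divr_gt0// mulr_gt0// ltr_wpDl.
near=> h.
have h0 : h != 0 by near: h; exact: nbhs_dnbhs_neq.
have hd : norm1 h <= delta.
  rewrite -lecR; apply: le_trans (norm1_le_norm h) _.
  rewrite [delta]splitr rmorphD -mulr2n ler_wMn2r//.
  by apply/ltW; near: h; exact: dnbhs0_lt.
have hr : `|h| <= (r / (4 * (M + 1)))%:C.
  by apply/ltW; near: h; exact: dnbhs0_lt.
rewrite /= -[h%:A]/(h * 1) mulr1 -[_ *: _]/(_ * _).
rewrite -normrN opprB (_ : _ - D =
    h^-1 * (series_sum u (h + z) - series_sum u z - h * D)); last first.
  by rewrite [RHS]mulrBr mulKf.
rewrite normrM normfV ler_pdivrMl ?normr_gt0//.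
apply: le_trans (norm_le_norm1 _) _.
have := norm1_le_norm h; have := norm1_ge0 h; have := rem h hd; move: hr.
move: (norm1 h) (norm1 _) => a b.
rewrite normc_def; set c := Num.sqrt _.
rewrite -rmorphMn -rmorphM !lecR ler_pdivlMr ?mulr_gt0 ?ltr_wpDl// mulr2n.
have c0 : 0 <= c by exact: sqrtr_ge0.
move=> cr ba a0 ac; apply: le_trans ba _.
apply: (@le_trans _ _ ((c + c) ^+ 2 * M)).
  by rewrite ler_wpM2r// ler_sqr ?nnegrE ?addr_ge0.
apply: le_trans (ler_wpM2l c0 cr); rewrite -subr_ge0.
rewrite (_ : _ - _ = 4 * c ^+ 2); last by ring.
by rewrite mulr_ge0 ?sqr_ge0.
Unshelve. all: by end_near.
Qed.

End GeometricSeries.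

(** * The zeta function *)

Section ZetaHolomorphic.
Variables (R : realType) (B : stationary_bratteli).
Variables (alpha : R) (a : seq (level_edge B) -> R).
Let l (t : seq (level_edge B)) : R := ln (weight alpha a t).

(** Three factors exp (delta |l t|) pay for the remainder: two absorb the square of [l t], and one
    bounds exp (norm1 h |l t|) for norm1 h <= delta. *)
Lemma zeta_term_cvg_derivable (z : R[i]^o) (delta K q : R) :
  0 < delta -> 0 <= q < 1 ->
  (forall n, \sum_(t : n.-tuple (level_edge B) | finite_path t)
    expR (complex.Re z * l t + 3 * (delta * `|l t|)) <= K * q ^+ n) ->
  cvgn (series ((zeta_term alpha a) ^~ z)) /\
  derivable (series_sum (zeta_term alpha a)) z 1.
Proof.
move=> d0 q01 EP.
(* The three summands are the constants for the terms, their derivatives and the remainders. *)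
pose C : R := 2 + 2 * delta^-1 + 4 * delta^-1 ^+ 2.
have di0 : 0 <= delta^-1 by rewrite invr_ge0 ltW.
pose d n : R[i]^o := \sum_(t : n.-tuple (level_edge B) | finite_path t)
  cpow (weight alpha a t) z * (l t)%:C.
have C1 : 2 <= C by rewrite /C -addrA lerDl addr_ge0// mulr_ge0 ?exprn_ge0.
have C2 : 2 * delta^-1 <= C.
  by rewrite /C [2 + _]addrC -addrA lerDl addr_ge0// mulr_ge0 ?exprn_ge0.
have C3 : 4 * delta^-1 ^+ 2 <= C by rewrite /C lerDr addr_ge0// mulr_ge0.
have E3 t : expR (complex.Re z * l t + 3 * (delta * `|l t|)) =
    expR (complex.Re z * l t) * expR (delta * `|l t|) ^+ 3.
  by rewrite expRD expRM_natl.
have X1 t : 1 <= expR (delta * `|l t|).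
  by rewrite -expR0 ler_expR mulr_ge0// ltW.
have bound n k c (F : n.-tuple (level_edge B) -> R[i]) : 0 <= k -> c <= C ->
    (forall t, norm1 (F t) <=
      k * (c * (expR (complex.Re z * l t) * expR (delta * `|l t|) ^+ 3))) ->
    norm1 (\sum_(t : n.-tuple (level_edge B) | finite_path t) F t) <=
    k * (C * K * q ^+ n).
  move=> k0 cC FP; apply: le_trans (norm1_sum _ _) _.
  apply: (@le_trans _ _ (k * (C * \sum_(t : n.-tuple (level_edge B) | finite_path t)
      expR (complex.Re z * l t + 3 * (delta * `|l t|))))).
    rewrite !mulr_sumr; apply: ler_sum => t _; apply: le_trans (FP t) _.
    by rewrite E3 ler_wpM2l// ler_wpM2r// mulr_ge0 ?exprn_ge0 ?expR_ge0.
  by rewrite ler_wpM2l// -mulrA ler_wpM2l// (le_trans _ C1).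
have ulez n : norm1 (zeta_term alpha a n z) <= C * K * q ^+ n.
  rewrite -[leRHS]mul1r; apply: (bound _ _ _ _ ler01 C1) => t.
  apply: le_trans (norm1_cpow _ _) _.
  by rewrite mul1r ler_wpM2l// ler_peMr ?expR_ge0// exprn_ege1.
split.
  have [S SP _] := cvg_complex_series_geometric_bound q01 ulez.
  by apply/cvg_ex; exists S.
apply: (derivable_series_sum (d := d) d0 q01 ulez) => [n|h hd n].
  rewrite -[leRHS]mul1r; apply: (bound _ _ _ _ ler01 C2) => t.
  apply: le_trans (norm1M _ _) _; rewrite norm1R mul1r.
  apply: le_trans (ler_pM (norm1_ge0 _) (normr_ge0 _) (norm1_cpow _ _)
    (norm_le_expR _ d0)) _.
  rewrite mulrACA ler_wpM2l ?mulr_ge0// ler_wpM2l ?expR_ge0//.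
  by rewrite ler_eXnr.
rewrite [X in norm1 X](_ : _ = \sum_(t : n.-tuple (level_edge B) | finite_path t)
    cpow (weight alpha a t) z * (cpow (weight alpha a t) h - 1 - h * (l t)%:C)).
  apply: (bound _ _ _ _ (sqr_ge0 _) C3) => t.
  apply: le_trans (norm1M _ _) _.
  apply: le_trans (ler_pM (norm1_ge0 _) (norm1_ge0 _) (norm1_cpow _ _)
    (norm1_cpowB1B _ _)) _.
  rewrite -/(l t).
  set P := expR (_ * l t); set X := expR (delta * _).
  have P0 : 0 <= P by exact: expR_ge0.
  have h1 : expR (norm1 h * `|l t|) <= X by rewrite ler_expR ler_wpM2r.
  have h2 : (norm1 h * `|l t|) ^+ 2 <= (norm1 h * (delta^-1 * X)) ^+ 2.
    rewrite ler_sqr ?nnegrE ?mulr_ge0 ?norm1_ge0 ?expR_ge0//.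
    by rewrite ler_wpM2l ?norm1_ge0// norm_le_expR.
  rewrite [leRHS](_ : _ = 2 * P * (2 * (norm1 h * (delta^-1 * X)) ^+ 2 * X)); last by ring.
  rewrite ler_wpM2l ?mulr_ge0// ler_pM ?mulr_ge0 ?sqr_ge0 ?norm1_ge0 ?expR_ge0//.
  by rewrite ler_wpM2l.
rewrite /zeta_term /d mulr_sumr -!sumrB; apply: eq_bigr => t _.
by rewrite cpowD; ring.
Qed.

End ZetaHolomorphic.

(** The bounds on [a] become an additive error on the logarithmic scale, uniform in the length of
    the path. *)
Lemma ln_weight_bound (R : realType) (B : stationary_bratteli)
    (alpha : R) (a : seq (level_edge B) -> R)
    (rho : edge_sequence B -> edge_sequence B -> R) :
  self_similar_ultrametric_cantor_set alpha a rho ->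
  exists2 L, 0 <= L & forall t, finite_path t ->
    `|ln (weight alpha a t) - (size t)%:R * ln alpha| <= L.
Proof.
case=> _ _ /andP[al0 al1] a_gt0 a_inf a_sup _ _.
have inf_le t : finite_path t ->
    (ereal_inf [set (a t)%:E | t in finite_paths (B := B)] <= (a t)%:E)%E.
  by move=> tP; apply: ereal_inf_lbound; exists t.
have sup_ge t : finite_path t ->
    ((a t)%:E <= ereal_sup [set (a t)%:E | t in finite_paths (B := B)])%E.
  by move=> tP; apply: ereal_sup_ubound; exists t.
(* The empty path shows that the set of coefficients is nonempty, which makes its infimum and
   supremum finite. *)
have nilP : finite_path ([::] : seq (level_edge B)) by [].
move: a_inf a_sup inf_le sup_ge.
case: (ereal_inf _) => [m| |] // m0; case: (ereal_sup _) => [M| |] // _ mP MP;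
  [|by have := MP _ nilP|by have := mP _ nilP|by have := mP _ nilP].
exists (`|ln m| + `|ln M|) => [|t tP]; first by rewrite addr_ge0.
rewrite lte_fin in m0.
have := mP t tP; rewrite lee_fin => mt; have := MP t tP; rewrite lee_fin => tM.
have at0 := a_gt0 t tP.
rewrite /weight lnM ?posrE ?exprn_gt0// lnXn// mulr_natl addrK.
have M0 : 0 < M by exact: lt_le_trans tM.
have h1 : ln m <= ln (a t) by rewrite ler_ln ?posrE.
have h2 : ln (a t) <= ln M by rewrite ler_ln ?posrE.
rewrite ler_norml; apply/andP; split.
  by have := ler_norm (- ln m); rewrite normrN; have := normr_ge0 (ln M); lra.
by have := ler_norm (ln M); have := normr_ge0 (ln m); lra.
Qed.

(** * The abscissa of convergence *)

Section Abscissa.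
Variables (R : realType) (B : stationary_bratteli).
Variables (alpha : R) (a : seq (level_edge B) -> R) (Lambda L : R).
Hypotheses (alpha01 : 0 < alpha < 1) (L_ge0 : 0 <= L).
Hypothesis (weightP : forall t, finite_path t ->
    `|ln (weight alpha a t) - (size t)%:R * ln alpha| <= L).
Hypothesis (HLambda : perron_frobenius_eigenvalue B Lambda).
Hypothesis (Lambda_gt1 : 1 < Lambda).

Let b : R := - ln alpha.
Let sigma : R := ln Lambda / b.
Let l (t : seq (level_edge B)) : R := ln (weight alpha a t).
Notation zeta := (series_sum (zeta_term alpha a)).

Let b_gt0 : 0 < b. Proof. by rewrite oppr_gt0 ln_lt0. Qed.

Let Lambda_gt0 : 0 < Lambda. Proof. exact: lt_trans Lambda_gt1. Qed.

Let sigma_gt0 : 0 < sigma. Proof. by rewrite divr_gt0// ln_gt0. Qed.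

Let lnLambdaE : ln Lambda = sigma * b.
Proof. by rewrite /sigma divfK// gt_eqF. Qed.

Let ln_weight n (t : n.-tuple (level_edge B)) : finite_path t ->
  - (b * n%:R) - L <= l t <= - (b * n%:R) + L.
Proof.
move=> /weightP; rewrite size_tuple -/(l t) ler_norml /b => /andP[h1 h2].
by apply/andP; split; lra.
Qed.

Lemma zeta_half_plane (z : R[i]^o) : half_plane sigma z ->
  cvgn (series ((zeta_term alpha a) ^~ z)) /\ derivable zeta z 1.
Proof.
rewrite /half_plane/=; set s := complex.Re z => sz.
(* The exponential gain e per level is shared out: e / 4 for the growth of the path count above
   Lambda, 3 delta b = e / 2 for the derivative estimates, and e / 4 remains as the decay of the
   majorant. *)
pose e : R := (s - sigma) * b.
have e0 : 0 < e by rewrite mulr_gt0// subr_gt0.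
pose delta : R := e / (6 * b).
have d0 : 0 < delta by rewrite divr_gt0// mulr_gt0.
have dE : delta * b = e / 6 by rewrite /delta; field; rewrite gt_eqF.
have [|C C0 CP] := @num_paths_le R B Lambda HLambda (Lambda * expR (e / 4)).
  by rewrite ltr_pMr// expR_gt1 divr_gt0.
apply: (@zeta_term_cvg_derivable R B alpha a z delta
  (C * expR ((`|s| + 3 * delta) * L)) (expR (- (e / 4)))) => //.
  by rewrite expR_ge0 expR_lt1 oppr_lt0 divr_gt0.
move=> n.
pose E : R := expR ((`|s| + 3 * delta) * L + n%:R * (e / 2 - s * b)).
apply: (@le_trans _ _ (\sum_(t : n.-tuple (level_edge B) | finite_path t) E)).
  apply: ler_sum => t tP; rewrite ler_expR -/s -/(l t).
  have /andP[h1 h2] := ln_weight tP.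
  have h3 : `|l t| <= b * n%:R + L.
    have := mulr_ge0 (ltW b_gt0) (ler0n R n).
    by rewrite ler_norml; move=> ?; apply/andP; split; lra.
  have h4 : s * l t <= `|s| * L - s * (b * n%:R).
    have : s * (l t + b * n%:R) <= `|s| * L.
      apply: le_trans (ler_norm _) _; rewrite normrM ler_wpM2l//.
      by rewrite ler_norml; apply/andP; split; lra.
    by rewrite mulrDr; lra.
  have h5 : delta * `|l t| <= delta * (b * n%:R + L) by rewrite ler_wpM2l// ltW.
  rewrite mulrDr mulrA dE in h5.
  apply: (le_trans (lerD h4 (ler_wpM2l (ler0n _ 3) h5))).
  by rewrite le_eqVlt; apply/orP; left; apply/eqP; field.
rewrite (_ : \sum_(_ | _) E = (num_paths B n)%:R * E); last first.
  by rewrite /num_paths natr_sum mulr_suml; apply: eq_bigr => t _; rewrite mul1r.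
apply: (le_trans (ler_wpM2r (expR_ge0 _) (CP n))).
rewrite -{1}(lnK (_ : Lambda \is Num.pos)) ?posrE// -expRD -!expRM_natl -!mulrA.
rewrite ler_pM2l// -!expRD ler_expR lnLambdaE le_eqVlt; apply/orP; left.
by rewrite /e; apply/eqP; field.
Qed.

Lemma Re_zeta_term_real n (s : R) : complex.Re (zeta_term alpha a n s%:C) =
  \sum_(t : n.-tuple (level_edge B) | finite_path t) expR (s * l t).
Proof.
rewrite raddf_sum; apply: eq_bigr => t _.
by rewrite /cpow /= mul0r cos0 mulr1.
Qed.

(** The geometric ratio on the left equals 1 exactly at s = [sigma]; this drives both the divergence
    at [sigma] and the blow-up to its right. *)
Lemma Re_zeta_term_ge n (s : R) : 0 <= s ->
  expR (- (s * (L + b))) * (Lambda * expR (- (s * b))) ^+ n <=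
  complex.Re (zeta_term alpha a n.+1 s%:C).
Proof.
move=> s0; rewrite Re_zeta_term_real.
pose E : R := expR (s * (- (b * n.+1%:R) - L)).
apply: (@le_trans _ _ ((num_paths B n.+1)%:R * E)); last first.
  rewrite /num_paths natr_sum mulr_suml; apply: ler_sum => t tP.
  rewrite mul1r ler_expR ler_wpM2l//.
  by have /andP[] := ln_weight tP.
apply: le_trans (ler_wpM2r (expR_ge0 _) (num_paths_ge HLambda n)).
rewrite exprMn mulrCA ler_pM2l ?exprn_gt0// -expRM_natl -expRD ler_expR.
by rewrite le_eqVlt -natr1; apply/orP; left; apply/eqP; ring.
Qed.

(** The terms stay above a positive constant, so they do not tend to 0. This rules out an abscissa
    below [sigma]. *)
Lemma not_cvg_zeta_sigma :
  ~ cvgn (series ((zeta_term alpha a) ^~ (sigma%:C : R[i]^o))).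
Proof.
move=> /cvg_series_cvg_0 /cvg_Re /cvgrPdist_lt.
move=> /(_ (expR (- (sigma * (L + b))))) /(_ (expR_gt0 _)) [n _].
move=> /(_ n.+1 (leqnSn n)) /=; rewrite sub0r normrN.
apply/negP; rewrite -leNgt; apply: le_trans (ler_norm _).
have := Re_zeta_term_ge n (ltW sigma_gt0); rewrite -lnLambdaE [expR (- ln _)]expRN.
by rewrite lnK ?posrE// divff ?gt_eqF// expr1n mulr1.
Qed.

Lemma zeta_singular : singular_at zeta sigma.
Proof.
move=> [U [g [Uo Us gh gE]]].
have /derivable1_diffP/differentiable_continuous/cvgrPdist_lt/(_ 1 ltr01) gc := gh _ Us.
have {gc} [e0 /= /gt0_complex[e e_gt0 ->] eP] : nbhs (sigma%:C : R[i]^o)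
    [set z | U z /\ `|g sigma%:C - g z| < 1].
  by apply: filterI => //; exact: open_nbhs_nbhs.
pose M := complex.Re (g sigma%:C) + 1.
(* A lower bound, uniform for s <= [sigma] + 1, for each of the terms 1 to N once [eta] is small; N
   is then chosen with N c > |M|. *)
pose c := expR (- ((sigma + 1) * (L + b))) * expR (- 1).
have c0 : 0 < c by rewrite mulr_gt0 ?expR_gt0.
have := archi_boundP (divr_ge0 (normr_ge0 M) (ltW c0)).
set N := Num.bound _; rewrite ltr_pdivrMr// => MN.
(* The three constraints keep s within the neighbourhood where Re g < M, keep s <= [sigma] + 1, and
   keep exp (- eta b k) >= exp (- 1) for k < N. *)
pose eta := Num.min (e / 2) (Num.min 1 (N.+1%:R * b)^-1).
have Nb0 : 0 < N.+1%:R * b by rewrite mulr_gt0.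
have eta0 : 0 < eta by rewrite !lt_min divr_gt0// ltr01 invr_gt0.
have eta_e : eta < e.
  by rewrite gt_min ltr_pdivrMr// ltr_pMr// ltr1n.
have eta1 : eta <= 1 by rewrite !ge_min lexx orbT.
have etaN : N.+1%:R * b * eta <= 1.
  by rewrite mulrC -ler_pdivlMr// mul1r !ge_min lexx !orbT.
pose s := sigma + eta.
have sz : half_plane sigma (s%:C : R[i]^o) by rewrite /half_plane/= ltrDl.
have [|Uz gz] := eP s%:C.
  rewrite /= -raddfB/= /s opprD addNKr.
  by rewrite normc_def/= expr0n addr0 sqrtr_sqr normrN gtr0_norm// ltcR.
have gM : complex.Re (g s%:C) < M.
  have := le_lt_trans (normc_ge_Re _) gz; rewrite ltcR raddfB/= distrC.
  by move=> /(le_lt_trans (ler_norm _)); rewrite /M; lra.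
suff cN : N%:R * c <= complex.Re (g s%:C).
  by have := ler_norm M; lra.
rewrite gE//.
have [zc _] := zeta_half_plane sz.
have s0 : 0 <= s by rewrite addr_ge0// ltW.
apply: ler_cvg_to (cvg_cst _) (cvg_Re zc) _.
exists N.+1 => // n /= Nn; rewrite raddf_sum /= (big_cat_nat (leq0n _) Nn)//=.
(* Term 0 and the terms beyond N are nonnegative and dropped; the lower bound starts at index 1. *)
rewrite big_nat_recl//= -addrA addrCA.
apply: ler_wpDr.
  rewrite addr_ge0 ?sumr_ge0// => [|k _].
    by rewrite Re_zeta_term_real sumr_ge0// => t _; exact: expR_ge0.
  by rewrite Re_zeta_term_real sumr_ge0// => t _; exact: expR_ge0.
rewrite -[N in N%:R]subn0 -sumr_const_nat mulr_suml.
apply: ler_sum_nat => k /andP[_ kN].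
rewrite mul1r; apply: le_trans (Re_zeta_term_ge k s0).
rewrite ler_pM ?expR_ge0//.
  by rewrite ler_expR lerN2 ler_wpM2r ?addr_ge0 ?(ltW b_gt0)// lerD2l.
have -> : Lambda * expR (- (s * b)) = expR (- (eta * b)).
  rewrite -{1}(lnK (_ : Lambda \is Num.pos)) ?posrE// -expRD lnLambdaE.
  by congr expR; rewrite /s; ring.
rewrite -expRM_natl ler_expR mulrN lerN2; apply: le_trans etaN.
rewrite [eta * b]mulrC mulrA !ler_wpM2r ?(ltW b_gt0) ?(ltW eta0)//.
by rewrite ler_nat ltnW// ltnS ltnW.
Qed.

Lemma open_half_plane (s : R) : open (half_plane s).
Proof.
rewrite openE => z; rewrite /half_plane/= => sz.
apply/nbhs_ballP; exists (complex.Re z - s)%:C => /=; first by rewrite ltcR subr_gt0.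
move=> w; rewrite -ball_normE/= => zw.
have := le_lt_trans (normc_ge_Re _) zw; rewrite ltcR raddfB/=.
by move=> /(le_lt_trans (ler_norm _)); lra.
Qed.

Lemma abscissa_sigma : abscissa_of_convergence (zeta_term alpha a) sigma.
Proof.
split => //; last exact: zeta_singular.
  by move=> s /zeta_half_plane[].
by move=> s /zeta_half_plane[].
Qed.

(** A smaller abscissa would force convergence at [sigma]; at a larger one, zeta on the half-plane
    right of [sigma] is itself a holomorphic extension. *)
Lemma abscissa_unique s : abscissa_of_convergence (zeta_term alpha a) s -> s = sigma.
Proof.
move=> [s0 sc _ ssing]; have [slt|sgt|//] := ltgtP s sigma.
  by case: not_cvg_zeta_sigma; exact: sc.
case: ssing; exists (half_plane sigma), zeta; split => //.
  exact: open_half_plane.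
by move=> z /zeta_half_plane[].
Qed.

End Abscissa.

Theorem lemma2p11 (R : realType) (B : stationary_bratteli)
    (alpha : R) (a : seq (level_edge B) -> R)
    (rho : edge_sequence B -> edge_sequence B -> R) (Lambda : R)
    (Hrho : self_similar_ultrametric_cantor_set alpha a rho)
    (HLambda : perron_frobenius_eigenvalue B Lambda) :
  (exists s0 : R, abscissa_of_convergence (zeta_term alpha a) s0) /\
  (forall s0 : R, abscissa_of_convergence (zeta_term alpha a) s0 ->
     s0 = ln Lambda / - ln alpha).
Proof.
have [cantor _ alpha01 _ _ _ _ _] := Hrho.
have [L L_ge0 weightP] := ln_weight_bound Hrho.
have Lambda_gt1 := perron_frobenius_gt1 cantor HLambda.
split; last by move=> s0; exact: (abscissa_unique alpha01 weightP HLambda Lambda_gt1).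
by eexists; exact: (abscissa_sigma alpha01 L_ge0 weightP HLambda Lambda_gt1).
Qed.
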